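(* If $H$ and $T$ are non-empty forests, then $H\succcurlyeq T$ if and only if the value of the linear program $LP(H,T)$ is equal to $e(T)$.
   Context: All graphs are finite, simple and undirected; a graph is non-empty if it has at least one edge; $v(\cdot)$, $e(\cdot)$ denote numbers of vertices and edges. $t(H,G)=\hom(H,G)/v(G)^{v(H)}$, where $\hom(H,G)$ is the number of graph homomorphisms from $H$ to $G$. For non-empty graphs $H,T$, $H\succcurlyeq T$ means $t(H,G)^{e(T)}\geq t(T,G)^{e(H)}$ for every graph $G$. Let $\mathrm{Hom}(H,T)$ be the set of homomorphisms $H\to T$. For $\varphi\in\mathrm{Hom}(H,T)$, let $\mu_\varphi(v)=|\varphi^{-1}(v)|$ for $v\in V(T)$ and $\mu_\varphi(e)$ be the number of edges $uv$ of $H$ with $\{\varphi(u),\varphi(v)\}=e$, for $e\in E(T)$. The linear program $LP(H,T)$ has variables $w(\varphi)$, $\varphi\in\mathrm{Hom}(H,T)$, and is: maximize $\sum_{e\in E(T)}\sum_{\varphi}\mu_\varphi(e)w(\varphi)$ subject to $\sum_\varphi \mu_\varphi(e)w(\varphi)\leq 1$ for all $e\in E(T)$, $\sum_\varphi\mu_\varphi(v)w(\varphi)\leq 1$ for all $v\in V(T)$, and $w(\varphi)\geq 0$ for all $\varphi$.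
   Formalization: The formal statement adds that H has no isolated vertices; without this the claim is false: for H = K2 plus an isolated vertex and T = K2, H dominates T but the value of LP(H,T) is at most 2/3 < 1 = e(T). *)

(* Defs.v *)
From HB Require Import structures.
From mathcomp Require Import all_boot all_order all_algebra.
From mathcomp Require Import all_classical all_reals.

Set Implicit Arguments.
Unset Strict Implicit.
Unset Printing Implicit Defensive.

Import Order.TTheory GRing.Theory Num.Theory.

Local Open Scope ring_scope.

Record sgraph := SGraph {
  vertex :> finType;
  adj : rel vertex;
  adj_sym : symmetric adj;
  adj_irrefl : irreflexive adj
}.

Definition edges (G : sgraph) : {set {set G}} :=
  [set [set p.1; p.2] | p : G * G & adj p.1 p.2]%SET.

Definition nv (G : sgraph) : nat := #|G|.
Definition ne (G : sgraph) : nat := #|edges G|.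

Definition nonempty_graph (G : sgraph) : Prop := (0 < ne G)%N.

(* Isolated vertices of H leave [homdens H G] unchanged but consume the vertex
   constraints of [lp_feasible]: for H = K2 + K1 and T = K2 the densities agree,
   so H dominates T, while the value of the program is 2/3 < 1 = e(T).  The
   equivalence between domination and the program thus needs this condition
   on H. *)
Definition no_isolated (G : sgraph) : Prop :=
  forall x : G, exists y : G, adj x y.

(* Every edge xy gives a [ucycle] [:: x; y], so cycles of a simple graph are
   those of length at least 3. *)
Definition is_forest (G : sgraph) : Prop :=
  forall c : seq G, ucycle (@adj G) c -> ~ (3 <= size c)%N.

Definition homs (H G : sgraph) : {set {ffun H -> G}} :=
  [set phi : {ffun H -> G} |
     [forall x, forall y, adj x y ==> adj (phi x) (phi y)]]%SET.

(* If G has no vertices and H has one, this is 0 / 0 = 0; both sides of the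
   inequality in [dominates] are then 0 for nonempty H and T. *)
Definition homdens (H G : sgraph) : rat :=
  #|homs H G|%:R / (nv G)%:R ^+ nv H.

Definition dominates (H T : sgraph) : Prop :=
  forall G : sgraph, homdens H G ^+ ne T >= homdens T G ^+ ne H.

Definition mu_vertex (H T : sgraph) (phi : {ffun H -> T}) (v : T) : nat :=
  #|[set x : H | phi x == v]%SET|.

Definition mu_edge (H T : sgraph) (phi : {ffun H -> T}) (e : {set T}) : nat :=
  #|[set f in edges H | phi @: f == e]%SET|.

(* The variables are the w phi for phi in [homs H T]; the other values of w are
   unconstrained and do not enter the objective. *)
Definition lp_feasible (R : realType) (H T : sgraph)
    (w : {ffun H -> T} -> R) : Prop :=
  [/\ forall e, e \in edges T ->
        \sum_(phi in homs H T) (mu_edge phi e)%:R * w phi <= 1,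
      forall v : T, \sum_(phi in homs H T) (mu_vertex phi v)%:R * w phi <= 1
    & forall phi, phi \in homs H T -> 0 <= w phi].

Definition lp_objective (R : realType) (H T : sgraph)
    (w : {ffun H -> T} -> R) : R :=
  \sum_(e in edges T) \sum_(phi in homs H T) (mu_edge phi e)%:R * w phi.

(* The program is feasible (w = 0) and its objective is at most [ne T], so this
   [sup] is a genuine supremum. *)
Definition lp_value (R : realType) (H T : sgraph) : R :=
  sup [set lp_objective w | w in @lp_feasible R H T]%classic.

(* Main.v *)
Require Import Defs.
From mathcomp Require Import all_boot all_order all_algebra.
From mathcomp Require Import reals exp.
From mathcomp Require Import ring lra.

(* By Ville's theorem either the linear program has a solution w for which all
   the edge constraints are tight, or there are natural weights on the edges
   and vertices of T under which e(T) cost(phi) > e(H) cost(id) for every phi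
   in Hom(H, T), where cost(phi) is the total weight of the image of phi.

   In the first case, let psi be a uniformly random homomorphism T -> G, let
   h(v) be the entropy of psi(v) and I(uv) the mutual information of psi(u)
   and psi(v).  Since T is a forest,
     ln hom(T, G) <= sum_v h(v) - sum_e I(e).
   For each phi, the Markov random field on the forest H whose edge marginals
   are those of psi o phi is supported on Hom(H, G), so
     ln hom(H, G) >= sum_x h(phi(x)) - sum_d I(phi(d)).
   Averaging over w and using h(v) <= ln v(G) gives domination.

   In the second case, blow up T so that vertex v has relative size 2^-kz(v)
   and edge e has density 2^-ky(e), where z and y are the weights.  Because H
   and T are forests each phi contributes exactly 2^-k cost(phi) to the
   densities, up to a constant independent of k, and a large k violates
   domination.  By weak duality, the same weights keep the value of the program
   below e(T). *)

Set Implicit Arguments.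
Unset Strict Implicit.
Unset Printing Implicit Defensive.

Import Order.TTheory GRing.Theory Num.Theory.

Local Open Scope ring_scope.

(** * A theorem of the alternative *)

Section Gordan.
Variables (F : realFieldType) (I : finType).
Implicit Types (S : seq {ffun I -> F}) (a v p m : {ffun I -> F}).

(** At least one vector occurs and all coefficients are positive, so membership of 0 is a genuine
    positive dependence among the vectors of [S]. *)
Inductive pos_comb S : {ffun I -> F} -> Prop :=
| PosCombMem a : a \in S -> pos_comb S a
| PosCombAdd a v : pos_comb S a -> pos_comb S v ->
    pos_comb S [ffun i => a i + v i]
| PosCombScale c a : 0 < c -> pos_comb S a -> pos_comb S [ffun i => c * a i].

Lemma pos_comb_trans S S' v :
  (forall a, a \in S' -> pos_comb S a) -> pos_comb S' v -> pos_comb S v.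
Proof.
move=> SS'; elim=> [a /SS' //|a w _ IHa _ IHw|c a c0 _ IH].
  exact: PosCombAdd.
exact: PosCombScale.
Qed.

Lemma pos_comb_coord0 S i v :
  (forall a, a \in S -> a i = 0) -> pos_comb S v -> v i = 0.
Proof.
move=> S0; elim=> [a /S0 //|a w _ IHa _ IHw|c a c0 _ IH].
  by rewrite ffunE IHa IHw addr0.
by rewrite ffunE IH mulr0.
Qed.

(** The choice of one variable in the elimination; either list of bounds may be empty. *)
Lemma exists_between (L U : seq F) :
  (forall l u, l \in L -> u \in U -> l < u) ->
  exists t, (forall l, l \in L -> l < t) /\ (forall u, u \in U -> t < u).
Proof.
elim: L => [|l L IH] LU.
  elim: U {LU} => [|u U [t [_ tU]]]; first by exists 0.
  exists (Num.min t (u - 1)); split=> // w; rewrite inE => /orP[/eqP->|wU].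
    by rewrite gt_min; apply/orP; right; lra.
  by rewrite gt_min tU.
have [|t [Lt tU]] := IH.
  by move=> l' u l'L uU; apply: LU => //; rewrite inE l'L orbT.
have [lt|tl] := ltP l t.
  by exists t; split=> // l'; rewrite inE => /orP[/eqP->//|/Lt].
(* Here [t <= l], so whatever exceeds [l] exceeds all of [L], and only the upper bounds remain. *)
have [t' [lt' t'U]] : exists t', l < t' /\ forall u, u \in U -> t' < u.
  have : forall u, u \in U -> l < u by move=> u uU; apply: LU; rewrite ?mem_head.
  elim: U {LU IH tU} => [|u U IHU] lU; first by exists (l + 1); split; [lra|].
  have [|t' [lt' t'U]] := IHU.
    by move=> w wU; apply: lU; rewrite inE wU orbT.
  have lu := lU u (mem_head _ _).
  exists (Num.min t' ((l + u) / 2)); split.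
    by rewrite lt_min lt'; lra.
  move=> w; rewrite inE gt_min => /orP[/eqP->|/t'U ->//].
  by apply/orP; right; lra.
exists t'; split=> // l'; rewrite inE => /orP[/eqP->//|/Lt]; lra.
Qed.

(* Fourier-Motzkin elimination of the coordinate at the head of [s]. *)
Lemma gordan_seq (s : seq I) S : uniq s ->
  (exists nu : I -> F, forall a, a \in S -> 0 < \sum_(i <- s) a i * nu i) \/
  (exists2 v, pos_comb S v & forall i, i \in s -> v i = 0).
Proof.
elim: s S => [|i s IH] S /=.
  case: S => [|a S] _; first by left; exists (fun=> 0).
  by right; exists a => //; apply: PosCombMem; rewrite mem_head.
move=> /andP[iNs us].
(* When [m i < 0 < p i], both coefficients are positive and coordinate [i] cancels. *)
pose elim p m : {ffun I -> F} := [ffun j => (- m i) * p j + p i * m j].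
pose S' := [seq a : {ffun I -> F} <- S | a i == 0] ++
  [seq elim p m | p <- [seq a : {ffun I -> F} <- S | 0 < a i],
                  m <- [seq a : {ffun I -> F} <- S | a i < 0]].
have elimE (nu : I -> F) p m : \sum_(j <- s) elim p m j * nu j =
    (- m i) * \sum_(j <- s) p j * nu j + p i * \sum_(j <- s) m j * nu j.
  rewrite !mulr_sumr -big_split; apply: eq_bigr => j _ /=.
  by rewrite ffunE; ring.
have [[nu nuP]|[v vS' v0]] := IH S' us.
  left.
  pose dot a := \sum_(j <- s) a j * nu j.
  (* Rows positive at [i] bound the value of [nu i] from below, negative ones from above; positivity
     on the rows [elim p m] makes these bounds compatible. *)
  have [|t [Lt tU]] := @exists_between
    [seq - dot p / p i | p <- [seq a : {ffun I -> F} <- S | 0 < a i]]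
    [seq dot m / - m i | m <- [seq a : {ffun I -> F} <- S | a i < 0]].
    move=> _ _ /mapP[p pP ->] /mapP[m mP ->].
    have := nuP (elim p m); rewrite elimE -!/(dot _) => pm.
    have {pm}: 0 < - m i * dot p + p i * dot m.
      by apply: pm; rewrite mem_cat allpairs_f ?orbT.
    move: pP mP; rewrite !mem_filter => /andP[pi _] /andP[mi _] pm.
    rewrite ltr_pdivrMr // mulrAC ltr_pdivlMr ?oppr_gt0 //.
    lra.
  exists (fun j => if j == i then t else nu j) => a aS.
  rewrite big_cons eqxx.
  rewrite (eq_big_seq (fun j => a j * nu j)); last first.
    by move=> j js; case: eqP => // ji; rewrite -ji js in iNs.
  rewrite -/(dot a); have [ai|ai|ai] := ltrgtP (a i) 0.
  - have /tU : dot a / - a i \in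
        [seq dot m / - m i | m <- [seq a : {ffun I -> F} <- S | a i < 0]].
      by apply/mapP; exists a => //; rewrite mem_filter ai.
    by rewrite ltr_pdivlMr ?oppr_gt0 //; nra.
  - have /Lt : - dot a / a i \in
        [seq - dot p / p i | p <- [seq a : {ffun I -> F} <- S | 0 < a i]].
      by apply/mapP; exists a => //; rewrite mem_filter ai.
    by rewrite ltr_pdivrMr //; nra.
  by rewrite ai mul0r add0r; apply: nuP; rewrite mem_cat mem_filter ai eqxx aS.
right; exists v; last first.
  move=> j; rewrite inE => /orP[/eqP->|/v0//].
  apply: pos_comb_coord0 vS' => a; rewrite mem_cat mem_filter.
  case/orP=> [/andP[/eqP->]//|/allpairsP[[p m] /= [_ _ ->]]].
  by rewrite ffunE; ring.
apply: pos_comb_trans vS' => a; rewrite mem_cat mem_filter.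
case/orP=> [/andP[_ aS]|/allpairsP[[p m] /= [pP mP ->]]].
  exact: PosCombMem.
move: pP mP; rewrite !mem_filter => /andP[pi pS] /andP[mi mS].
have -> : elim p m = [ffun j => [ffun j => (- m i) * p j] j + [ffun j => p i * m j] j].
  by apply/ffunP=> j; rewrite !ffunE.
apply: PosCombAdd; apply: PosCombScale; rewrite ?oppr_gt0 //; exact: PosCombMem.
Qed.

(** Gordan's alternative for the rows of [A] together with the unit vectors: on one side the unit
    vectors force [nu] to be positive, on the other they are the slack that turns equations into
    inequalities. *)
Lemma ville (J : finType) (D : {set J}) (A : J -> I -> F) :
  (exists2 nu : I -> F, (forall i, 0 < nu i) &
     forall j, j \in D -> 0 < \sum_i A j i * nu i) \/
  (exists2 la : J -> F, (forall j, 0 <= la j) /\ 0 < \sum_(j in D) la j &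
     forall i, \sum_(j in D) A j i * la j <= 0).
Proof.
pose unitv i : {ffun I -> F} := [ffun j => (j == i)%:R].
pose rowv j : {ffun I -> F} := [ffun i => A j i].
pose S := [seq rowv j | j in D] ++ [seq unitv i | i : I].
have [[nu nuP]|[v vS v0]] := @gordan_seq (index_enum I) S (index_enum_uniq I).
  left; exists nu => [i|j jD].
    have := nuP (unitv i); rewrite mem_cat image_f ?orbT // => /(_ isT).
    rewrite (bigD1 i) //= big1 ?ffunE ?eqxx ?mul1r ?addr0 // => j ji.
    by rewrite ffunE (negbTE ji) mul0r.
  have := nuP (rowv j); rewrite mem_cat image_f // => /(_ isT).
  by under eq_bigr do rewrite ffunE.
right.
(* [la] records the coefficients of the rows. If only unit vectors occur, then [v] is nonnegative
   and nonzero, which [v0] excludes. *)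
have {vS} [la [la0 lav lap]] : exists la : J -> F, [/\ forall j, 0 <= la j,
    forall i, \sum_(j in D) A j i * la j <= v i &
    0 < \sum_(j in D) la j \/ (forall i, 0 <= v i) /\ exists i, 0 < v i].
  elim: vS {v0} => [a|a u _ [la [la0 laa lap]] _ [lv [lv0 lvv lvp]]|
                    c a c0 _ [la [la0 laa lap]]].
  - rewrite mem_cat => /orP[/imageP[j jD ->]|/imageP[i _ ->]].
      exists (fun k => (k == j)%:R); split=> [k|i|]; first exact: ler0n.
        rewrite (bigD1 j) //= big1 ?eqxx ?addr0 ?ffunE ?mulr1 // => k /andP[_ kj].
        by rewrite (negbTE kj) mulr0.
      left; rewrite (bigD1 j) //= eqxx; apply: ltr_wpDr => //.
      by apply: sumr_ge0 => k _; exact: ler0n.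
    exists (fun=> 0); split=> // [k|].
      by rewrite big1 ?ffunE ?ler0n // => j _; rewrite mulr0.
    by right; split=> [k|]; [|exists i]; rewrite ffunE ?ler0n ?eqxx.
  - exists (fun j => la j + lv j); split=> [j|i|]; first exact: addr_ge0.
      under eq_bigr do rewrite mulrDr.
      by rewrite big_split ffunE lerD.
    rewrite big_split /=.
    have sa : 0 <= \sum_(j in D) la j by apply: sumr_ge0.
    have sv : 0 <= \sum_(j in D) lv j by apply: sumr_ge0.
    case: lap => [lap|[a0 [i ai]]]; first by left; lra.
    case: lvp => [lvp|[v0 _]]; first by left; lra.
    by right; split=> [k|]; [|exists i]; rewrite ffunE ?addr_ge0 ?ltr_wpDr.
  exists (fun j => c * la j); split=> [j|i|]; first by rewrite mulr_ge0 // ltW.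
    under eq_bigr do rewrite mulrCA.
    by rewrite -mulr_sumr ffunE ler_pM2l.
  rewrite -mulr_sumr; case: lap => [lap|[a0 [i ai]]]; first by left; rewrite mulr_gt0.
  by right; split=> [k|]; [|exists i]; rewrite ffunE ?mulr_ge0 ?mulr_gt0 // ltW.
exists la; last first.
  by move=> i; apply: le_trans (lav i) _; rewrite v0 ?mem_index_enum.
split=> //; case: lap => // -[_ [i]].
by rewrite v0 ?ltxx ?mem_index_enum.
Qed.

End Gordan.

(** * Forests *)

Lemma edgesP (G : sgraph) (e : {set G}) :
  reflect (exists x y : G, adj x y /\ e = [set x; y]) (e \in edges G).
Proof.
apply: (iffP imsetP) => [[[x y] xy ->]|[x [y [xy ->]]]].
  by rewrite inE in xy; exists x, y.
by exists (x, y); rewrite ?inE.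
Qed.

Lemma mem_edges (G : sgraph) (x y : G) : adj x y -> [set x; y] \in edges G.
Proof. by move=> xy; apply/edgesP; exists x, y. Qed.

Lemma adj_neq (G : sgraph) (x y : G) : adj x y -> x != y.
Proof. by apply: contraTneq => ->; rewrite adj_irrefl. Qed.

Lemma homsP (H G : sgraph) (phi : {ffun H -> G}) :
  reflect (forall x y, adj x y -> adj (phi x) (phi y)) (phi \in homs H G).
Proof.
rewrite inE; apply: (iffP forallP) => [h x y xy|h x].
  by move: (h x) => /forallP/(_ y)/implyP; apply.
by apply/forallP=> y; apply/implyP; apply: h.
Qed.

Lemma hom_edge (H G : sgraph) (phi : {ffun H -> G}) e :
  phi \in homs H G -> e \in edges H -> phi @: e \in edges G.
Proof.
move=> /homsP hphi /edgesP[x [y [xy ->]]].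
by rewrite imsetU1 imset_set1 mem_edges ?hphi.
Qed.

Lemma hom_edge_inj (H G : sgraph) (phi : {ffun H -> G}) e :
  phi \in homs H G -> e \in edges H -> {in e &, injective phi}.
Proof.
move=> /homsP hphi /edgesP[x [y [xy ->]]] u v; rewrite !inE.
have := adj_neq (hphi _ _ xy).
by move=> ne /orP[]/eqP-> /orP[]/eqP->// E; move: ne; rewrite E eqxx.
Qed.

(** Otherwise paths inside [S] could be extended without end. The vertex [x] is the one removed in
    inductions over [S]. *)
Lemma forest_leaf (G : sgraph) (S : {set G}) : is_forest G -> S != set0 ->
  exists2 x, x \in S &
    forall y z, y \in S -> z \in S -> adj x y -> adj x z -> y = z.
Proof.
move=> forG S0; have [x0 x0S] := set0Pn _ S0.
pose leaf x := [forall y in S, forall z in S, adj x y ==> adj x z ==> (y == z)].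
have [/existsP[x /andP[xS lx]]|noleaf] := boolP [exists x in S, leaf x].
  exists x => // y z yS zS xy xz; apply/eqP.
  move: lx => /forall_inP/(_ y yS)/forall_inP/(_ z zS).
  by rewrite xy xz.
have two x : x \in S -> exists y z, [/\ y \in S, z \in S, adj x y, adj x z & y != z].
  move=> xS; move: noleaf; rewrite negb_exists => /forallP/(_ x).
  rewrite xS /= negb_forall_in => /exists_inP[y yS].
  rewrite negb_forall_in => /exists_inP[z zS].
  by rewrite !negb_imply => /and3P[xy xz yz]; exists y, z.
(* Every vertex of S has two neighbours in S, so simple paths never get stuck. *)
have long n : exists x p, [/\ uniq (x :: p), path (@adj G) x p,
    {subset x :: p <= S} & size p = n].
  elim: n => [|n [x [p [up pp pS sp]]]].
    by exists x0, [::]; split=> // y; rewrite inE => /eqP->.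
  (* The path grows at its front, and the new vertex must differ from the second one, [head x p];
     for empty [p] this default is [x] itself. *)
  have [y [yS xy yp]] : exists y, [/\ y \in S, adj x y & y != head x p].
    have [y [z [yS zS xy xz yz]]] := two x (pS _ (mem_head _ _)).
    have [yh|] := eqVneq y (head x p); last by exists y.
    by exists z; split=> //; rewrite -yh eq_sym.
  have yx : y != x by rewrite eq_sym adj_neq.
  (* A vertex already on the path closes a cycle; as it is not the head of [p], the cycle has length
     at least 3. *)
  have [yinp|ynp] := boolP (y \in p).
    case/splitPr: yinp up pp yp {pS sp} => p1 p2 up pp yp.
    case: p1 up pp yp => [|z p1] up pp yp; first by rewrite /= eqxx in yp.
    case: (@forG (x :: rcons (z :: p1) y)); last by rewrite /= size_rcons.
    have Ep : (z :: p1) ++ y :: p2 = rcons (z :: p1) y ++ p2 by rewrite cat_rcons.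
    rewrite Ep in up pp.
    apply/andP; split; last first.
      by move: up; rewrite -cat_cons cat_uniq => /andP[].
    move: pp; rewrite cat_path => /andP[pp _].
    by rewrite (cycle_path x) last_cons last_rcons [path _ _ _]/= adj_sym xy.
  exists y, (x :: p); split=> /=.
  - by rewrite inE negb_or yx ynp.
  - by rewrite adj_sym xy.
  - by move=> z; rewrite inE => /orP[/eqP->//|/pS].
  - by rewrite sp.
have [x [p [up _ _ sp]]] := long #|G|.
by have := max_card (mem (x :: p)); rewrite (card_uniqP up) /= sp ltnn.
Qed.

(** * Markov random fields on forests *)

Lemma set_card_ind (T : finType) (Q : {set T} -> Prop) :
  (forall S : {set T},
     (forall S' : {set T}, (#|S'| < #|S|)%N -> Q S') -> Q S) -> forall S, Q S.
Proof.
move=> QS S; have [n] := ubnP #|S|; elim: n S => // n IH S Sn.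
by apply: QS => S' S'S; apply: IH; apply: leq_trans S'S Sn.
Qed.

Section MarkovField.
Variables (R : realFieldType) (V : sgraph) (A : finType).
Implicit Types (S U e : {set V}) (f g : {ffun V -> A}) (F : {ffun V -> A} -> R).

Definition upd f x a : {ffun V -> A} := [ffun z => if z == x then a else f z].

Definition depends_only_on U F := forall f g, {in U, f =1 g} -> F f = F g.

Lemma upd_same f x a : upd f x a x = a.
Proof. by rewrite ffunE eqxx. Qed.

Lemma upd_other f x a z : z != x -> upd f x a z = f z.
Proof. by rewrite ffunE => /negbTE->. Qed.

Lemma updC f x y a b : x != y -> upd (upd f x a) y b = upd (upd f y b) x a.
Proof.
by move=> xy; apply/ffunP=> z; rewrite !ffunE; case: eqP => // ->; rewrite eq_sym (negbTE xy).
Qed.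

(** Assignments on [S] are encoded as total functions frozen to [f0] off [S], so that [S] can shrink
    without a change of type. *)
Definition agree_off S f0 f := [forall x, (x \notin S) ==> (f x == f0 x)].

Lemma sum_upd S f0 x F : x \in S ->
  \sum_(f | agree_off S f0 f) F f =
  \sum_(f | agree_off (S :\ x) f0 f) \sum_a F (upd f x a).
Proof.
move=> xS.
rewrite (partition_big (fun f => upd f x (f0 x)) (agree_off (S :\ x) f0)) /=; last first.
  move=> f /forallP fS; apply/forallP=> z; apply/implyP.
  rewrite !inE negb_and negbK ffunE; case: eqP => [->//|_ /= zS].
  by move: (fS z); rewrite zS.
apply: eq_bigr => f /forallP fS.
have fx : f x = f0 x by move: (fS x); rewrite !inE eqxx => /eqP.
rewrite (reindex_onto (fun a => upd f x a) (fun g => g x)) /=; last first.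
  move=> g /andP[_ /eqP <-]; apply/ffunP=> z.
  by rewrite !ffunE; case: eqP => [->|].
apply: eq_bigl => a; rewrite upd_same eqxx andbT; apply/andP; split.
  apply/forallP=> z; apply/implyP=> zS.
  have zx : z != x by apply: contraNneq zS => ->.
  by move: (fS z); rewrite upd_other // !inE (negbTE zS) andbF.
by apply/eqP/ffunP=> z; rewrite !ffunE; case: eqP => [->|].
Qed.

Variables (P : V -> A -> R) (rho : {set V} -> {ffun V -> A} -> R).

Definition edges_in S := [set e in edges V | e \subset S].

(* The law with vertex marginals [P] and with density [rho e] on each edge [e]
   relative to the product of the marginals of its ends. *)
Definition markov_field S f :=
  (\prod_(x in S) P x (f x)) * \prod_(e in edges_in S) rho e f.

Definition expect S f0 F := \sum_(f | agree_off S f0 f) markov_field S f * F f.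

Hypothesis V_forest : is_forest V.
Hypothesis P_sum : forall x, \sum_a P x a = 1.
Hypothesis rho_local : forall e, e \in edges V -> depends_only_on e (rho e).
(** The conditional law at [x] given the value at [y] has mass 1. A value at [y] of mass 0 is
    excluded because the pulled-back densities are 0 there. *)
Hypothesis rho_sum : forall x y f, adj x y -> P y (f y) != 0 ->
  \sum_a P x a * rho [set x; y] (upd f x a) = 1.

Lemma expect_upd S f0 x F : x \in S ->
  expect S f0 F = expect (S :\ x) f0 (fun f => \sum_a P x a *
    (\prod_(e in edges_in S | x \in e) rho e (upd f x a)) * F (upd f x a)).
Proof.
move=> xS; rewrite /expect (sum_upd _ _ xS); apply: eq_bigr => f _.
rewrite mulr_sumr; apply: eq_bigr => a _.
rewrite !mulrA; congr (_ * _); rewrite /markov_field (big_setD1 x xS) /= upd_same.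
rewrite (bigID (fun e : {set V} => x \in e)) /=.
have -> : \prod_(y in S :\ x) P y (upd f x a y) = \prod_(y in S :\ x) P y (f y).
  by apply: eq_bigr => y; rewrite !inE => /andP[yx _]; rewrite upd_other.
have -> : \prod_(e in edges_in S | x \notin e) rho e (upd f x a) =
          \prod_(e in edges_in (S :\ x)) rho e f.
  apply: eq_big => [e|e /andP[]]; first by rewrite !inE subsetD1 andbA.
  rewrite inE => /andP[eE _] xe; apply: rho_local => // z ze.
  by rewrite upd_other //; apply: contraNneq xe => <-.
ring.
Qed.

Lemma field_supp S f x : markov_field S f != 0 -> x \in S -> P x (f x) != 0.
Proof.
move=> q0 xS; apply: contraNneq q0 => Px.
by rewrite /markov_field (big_setD1 x xS) /= Px !mul0r.
Qed.

Lemma field_supp_edge S f e : markov_field S f != 0 -> e \in edges_in S -> rho e f != 0.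
Proof.
move=> q0 eS; apply: contraNneq q0 => re.
by rewrite /markov_field [X in _ * X](big_setD1 e eS) /= re mul0r mulr0.
Qed.

(** Integrating out a leaf [x] leaves at most one edge factor, that of the edge to its only
    neighbour [y] in [S]. *)
Lemma expect_leaf S f0 : S != set0 -> exists2 x, x \in S &
  (forall F, expect S f0 F =
     expect (S :\ x) f0 (fun f => \sum_a P x a * F (upd f x a))) /\
     (forall z, z \in S -> ~~ adj x z) \/
  exists2 y, y \in S /\ adj x y & (forall F, expect S f0 F =
     expect (S :\ x) f0 (fun f =>
       \sum_a P x a * rho [set x; y] (upd f x a) * F (upd f x a))) /\
     (forall z, z \in S -> adj x z -> z = y).
Proof.
move=> /(forest_leaf V_forest)[x xS leaf]; exists x => //.
have [/existsP[y /andP[yS xy]]|/existsPn none] := boolP [exists y in S, adj x y].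
  right; exists y => //; split=> [F|z zS xz]; last exact: leaf.
  rewrite (expect_upd _ _ xS); apply: eq_bigr => f _; congr (_ * _).
  apply: eq_bigr => a _; congr (_ * _ * _).
  rewrite (big_pred1 [set x; y]) // => e; rewrite inE.
  apply/idP/eqP => [/andP[/andP[/edgesP[u [v [uv ->]]] sub] xe]|->].
    have [uS vS] : u \in S /\ v \in S.
      by split; apply: (subsetP sub); rewrite !inE eqxx ?orbT.
    move: xe uv; rewrite !inE => /orP[]/eqP<- uv.
      by rewrite (leaf y v).
    by rewrite adj_sym in uv; rewrite (leaf y u) // setUC.
  rewrite mem_edges //= set21 andbT; apply/subsetP=> z.
  by rewrite !inE => /orP[]/eqP->.
left; split=> [F|z zS]; last by move: (none z); rewrite zS.
rewrite (expect_upd _ _ xS); apply: eq_bigr => f _; congr (_ * _).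
apply: eq_bigr => a _; rewrite big_pred0 ?mulr1 // => e; rewrite inE.
apply/negP=> /andP[/andP[/edgesP[u [v [uv ->]]] sub] xe].
have [uS vS] : u \in S /\ v \in S.
  by split; apply: (subsetP sub); rewrite !inE eqxx ?orbT.
move: xe uv; rewrite !inE => /orP[]/eqP<- uv.
  by move: (none v); rewrite vS uv.
by move: (none u); rewrite uS adj_sym uv.
Qed.

Lemma expect_ext S f0 F1 F2 : (forall f, markov_field S f != 0 -> F1 f = F2 f) ->
  expect S f0 F1 = expect S f0 F2.
Proof.
move=> F12; apply: eq_bigr => f _.
by have [->|/F12->//] := eqVneq (markov_field S f) 0; rewrite !mul0r.
Qed.

(** A function that ignores the leaf only sees the conditional mass there, which is 1 by [P_sum] or
    [rho_sum]. *)
Lemma expect_leaf_drop S f0 : S != set0 -> exists2 x, x \in S &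
  (forall F, (forall f a, F (upd f x a) = F f) ->
     expect S f0 F = expect (S :\ x) f0 F) /\
  ((forall F, expect S f0 F =
     expect (S :\ x) f0 (fun f => \sum_a P x a * F (upd f x a))) /\
     (forall z, z \in S -> ~~ adj x z) \/
  exists2 y, y \in S /\ adj x y & (forall F, expect S f0 F =
     expect (S :\ x) f0 (fun f =>
       \sum_a P x a * rho [set x; y] (upd f x a) * F (upd f x a))) /\
     (forall z, z \in S -> adj x z -> z = y)).
Proof.
move=> /(expect_leaf f0)[x xS leaf]; exists x => //; split=> // F Fx.
case: leaf => [[-> _]|[y [yS xy] [-> _]]]; apply: expect_ext => f q0.
  by under eq_bigr do rewrite Fx; rewrite -mulr_suml P_sum mul1r.
under eq_bigr do rewrite Fx; rewrite -mulr_suml rho_sum ?mul1r //.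
by apply: field_supp q0 _; rewrite !inE yS eq_sym adj_neq.
Qed.

(** The leaves are removed one by one; on the empty set the field is an empty product. *)
Lemma expect_cst S f0 c : expect S f0 (fun=> c) = c.
Proof.
elim/set_card_ind: S => S IH; have [->|S0] := eqVneq S set0.
  rewrite /expect (big_pred1 f0) => [|f].
    rewrite /markov_field big_set0 mul1r big_pred0 ?mul1r // => e.
    rewrite inE subset0; apply/negP=> /andP[/edgesP[x [y [_ ->]]]].
    by move=> /eqP/setP/(_ x); rewrite !inE eqxx.
  apply/forallP/eqP => [ff|-> x]; last by rewrite eqxx implybT.
  by apply/ffunP=> x; move: (ff x); rewrite inE => /eqP.
have [x xS [-> // _]] := expect_leaf_drop f0 S0.
by apply: IH; rewrite [X in (_ < X)%N](cardsD1 x) xS.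
Qed.

(** Leaves other than [z] drop out; if [z] is itself a leaf with a neighbour, the marginal of that
    neighbour is known by induction. Hence [P z] is the marginal at [z]. *)
Lemma expect1 S f0 z F : z \in S -> depends_only_on [set z] F ->
  expect S f0 F = \sum_a P z a * F (upd f0 z a).
Proof.
elim/set_card_ind: S z F => S IH z F zS Fz; have S0 : S != set0 by apply/set0Pn; exists z.
have [x xS [drop step]] := expect_leaf_drop f0 S0.
have ltS : (#|S :\ x| < #|S|)%N by rewrite [X in (_ < X)%N](cardsD1 x) xS.
have [zx|zx] := eqVneq z x; last first.
  rewrite drop ?(IH _ ltS z) //; first by rewrite !inE zx.
  by move=> f a; apply: Fz => w; rewrite inE => /eqP->; rewrite upd_other.
rewrite {z}zx in zS Fz *.
have Fupd f a : F (upd f x a) = F (upd f0 x a).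
  by apply: Fz => w; rewrite inE => /eqP->; rewrite !upd_same.
case: step => [[-> _]|[y [yS xy] [-> _]]].
  by rewrite -[RHS](expect_cst (S :\ x) f0); apply: eq_bigr => f _; under eq_bigr do rewrite Fupd.
have yx : y != x by rewrite eq_sym adj_neq.
rewrite (IH _ ltS y); first last.
- move=> f g fg; apply: eq_bigr => a _; rewrite !Fupd; congr (_ * _ * _).
  apply: rho_local; first exact: mem_edges.
  move=> w; rewrite !inE => /orP[]/eqP->; first by rewrite !upd_same.
  by rewrite !upd_other // fg // inE.
- by rewrite !inE yx.
under eq_bigr do rewrite mulr_sumr.
rewrite exchange_big /=; apply: eq_bigr => a _.
(* The sum over [b] is [rho_sum] with the two ends exchanged, which requires [P x a] to be nonzero;
   if it is 0, both sides vanish. *)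
have [->|Pa] := eqVneq (P x a) 0.
  by rewrite mul0r big1 // => b _; rewrite !mul0r mulr0.
rewrite -[RHS]mulr1 -(@rho_sum y x (upd f0 x a)) ?upd_same 1?adj_sym //.
rewrite mulr_sumr; apply: eq_bigr => b _.
rewrite Fupd updC // setUC; ring.
Qed.

(** Leaves off the edge drop out until one end is a leaf; the other end is then its unique
    neighbour, whose marginal is given by [expect1]. *)
Lemma expect2 S f0 x y F : x \in S -> y \in S -> adj x y -> depends_only_on [set x; y] F ->
  expect S f0 F = \sum_a \sum_b P x a * P y b *
    rho [set x; y] (upd (upd f0 x a) y b) * F (upd (upd f0 x a) y b).
Proof.
elim/set_card_ind: S x y F => S IH u v F uS vS uv Fuv.
have S0 : S != set0 by apply/set0Pn; exists u.
have [x xS [drop step]] := expect_leaf_drop f0 S0.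
have ltS : (#|S :\ x| < #|S|)%N by rewrite [X in (_ < X)%N](cardsD1 x) xS.
(* Stated for the leaf [x] and any neighbour, to serve both orientations of the edge [uv]. *)
have key y : y \in S -> adj x y -> depends_only_on [set x; y] F ->
    expect S f0 F = \sum_b \sum_a P x a * P y b *
      rho [set x; y] (upd (upd f0 y b) x a) * F (upd (upd f0 y b) x a).
  move=> yS xy Fxy.
  have yx : y != x by rewrite eq_sym adj_neq.
  have loc2 f g a G : depends_only_on [set x; y] G -> f y = g y -> G (upd f x a) = G (upd g x a).
    move=> locG fg; apply: locG => w; rewrite !inE => /orP[]/eqP->.
      by rewrite !upd_same.
    by rewrite !upd_other.
  case: step => [[_ /(_ y yS)]|[y' [y'S xy'] [-> /(_ y yS xy) Ey]]]; first by rewrite xy.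
  rewrite -{}Ey in y'S xy' *.
  rewrite (expect1 _ (z := y)); first last.
  - move=> f g fg; apply: eq_bigr => a _; congr (_ * _ * _); apply: loc2 => //.
    + by apply: rho_local; apply: mem_edges.
    + by apply: fg; rewrite inE.
    + by apply: fg; rewrite inE.
  - by rewrite !inE yx.
  by apply: eq_bigr => b _; rewrite mulr_sumr; apply: eq_bigr => a _; ring.
have [xu|xu] := eqVneq x u.
  rewrite xu in key; rewrite (key v) // exchange_big /=.
  by apply: eq_bigr => a _; apply: eq_bigr => b _; rewrite updC // eq_sym adj_neq.
have [xv|xv] := eqVneq x v.
  rewrite xv in key; rewrite (key u) //; first last.
    by rewrite setUC.
    by rewrite adj_sym.
  by apply: eq_bigr => a _; apply: eq_bigr => b _; rewrite setUC [P v b * _]mulrC.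
rewrite eq_sym in xu; rewrite eq_sym in xv.
rewrite drop ?(IH _ ltS u v) // ?inE ?xu ?xv //.
move=> f a; apply: Fuv => w; rewrite !inE => /orP[]/eqP->;
  by rewrite upd_other.
Qed.

End MarkovField.

(** * Blow-ups *)

(** The bits in [X] and [Y] are determined and all others are free; the product form avoids a
    subtraction in the exponent. *)
Lemma card_prescribed (B : finType) (X Y C : {set B}) : [disjoint X & Y] ->
  (#|[set a : {set B} | (a :&: X == set0) && (a :&: Y == C :&: Y)]|
     * 2 ^ (#|X| + #|Y|) = 2 ^ #|B|)%N.
Proof.
move=> dXY.
have -> : [set a : {set B} | (a :&: X == set0) && (a :&: Y == C :&: Y)] =
    [set s :|: (C :&: Y) | s in powerset (~: (X :|: Y))].
  apply/setP=> a; rewrite inE; apply/andP/imsetP => [[/eqP aX /eqP aY]|[s]].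
    exists (a :\: (X :|: Y)); first by rewrite inE subsetDr.
    rewrite -aY; apply/setP=> b; rewrite !inE.
    have := in_set0 b; rewrite -aX inE.
    by case: (b \in a); case: (b \in X); case: (b \in Y).
  rewrite inE => /subsetP sXY ->; split; apply/eqP/setP=> b; rewrite !inE.
    apply/negP=> /andP[/orP[bs|/andP[_ bY]] bX].
      by have := sXY b bs; rewrite !inE bX.
    by have := disjointFr dXY bX; rewrite bY.
  have [/sXY|_] := boolP (b \in s); last by rewrite -andbA andbb.
  by rewrite !inE negb_or => /andP[_ /negbTE->]; rewrite !andbF.
rewrite card_in_imset ?card_powerset.
  by rewrite -expnD -cardsUI (_ : X :&: Y = set0) ?cards0 ?addn0 ?cardsC //;
    [rewrite addnC cardsC | apply/eqP; rewrite setI_eq0].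
move=> s t; rewrite !inE => /subsetP sXY /subsetP tXY /setP E; apply/setP=> b.
have := E b; have := sXY b; have := tXY b; rewrite !inE.
by case: (b \in s); case: (b \in t); case: (b \in X); case: (b \in Y);
  case: (b \in C) => //= h1 h2 // _; by [have := h1 isT | have := h2 isT].
Qed.

Lemma prod_natr_bool (R : comPzRingType) (I : finType) (D : {pred I}) (b : pred I) :
  \prod_(i in D) (b i)%:R = [forall i in D, b i]%:R :> R.
Proof.
have [/forall_inP bD|/forall_inPn[i iD /negbTE bi]] := boolP [forall i in D, b i].
  by rewrite big1 // => i /bD->.
by rewrite (bigD1 i) //= bi mul0r.
Qed.

Section Blowup.
Variables (T : sgraph) (m : {set T} + T -> nat).

(** Disjoint blocks of bits, [m i] of them for each index [i], so that conditions on different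
    blocks are independent. *)
Definition bit : finType := {i : {set T} + T & 'I_(m i)}.

Definition block i : {set bit} := [set b | tag b == i].

Lemma card_block i : #|block i| = m i.
Proof.
have inj : injective (fun j : 'I_(m i) => Tagged (fun i => 'I_(m i)) j : bit).
  by move=> j l E; apply: eq_from_Tagged E.
rewrite -[RHS]card_ord -(card_imset _ inj); apply: eq_card => b.
rewrite inE; apply/idP/imsetP => [|[j _ ->]]; last exact: eqxx.
by case: b => k j /= /eqP ki; case: _ / ki j => j; exists j.
Qed.

Lemma block_disjoint i j : i != j -> [disjoint block i & block j].
Proof.
move=> ij; rewrite -setI_eq0; apply/eqP/setP=> b; rewrite !inE.
by case: eqP => // ->; rewrite (negbTE ij).
Qed.

(* Over [v], only the sets that avoid [block (inr v)] are non-isolated, a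
   proportion [2 ^ - m (inr v)]; between these, the pairs over an edge [e] have
   density [2 ^ - m (inl e)]. *)
Definition blow_adj (p q : T * {set bit}) :=
  [&& adj p.1 q.1, p.2 :&: block (inr p.1) == set0,
      q.2 :&: block (inr q.1) == set0 &
      p.2 :&: block (inl [set p.1; q.1]) == q.2 :&: block (inl [set p.1; q.1])].

Lemma blow_adj_sym : symmetric blow_adj.
Proof.
move=> p q; rewrite /blow_adj adj_sym setUC; congr (_ && _).
by rewrite andbCA; congr [&& _, _ & _]; rewrite eq_sym.
Qed.

Lemma blow_adj_irrefl : irreflexive blow_adj.
Proof. by move=> p; rewrite /blow_adj adj_irrefl. Qed.

Definition blowup : sgraph := SGraph blow_adj_sym blow_adj_irrefl.

Definition cost (H : sgraph) (phi : {ffun H -> T}) : nat :=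
  \sum_x m (inr (phi x)) + \sum_(e in edges H) m (inl (phi @: e)).

(** * Bit assignments over a fixed homomorphism *)

Section Lifts.
Variables (H : sgraph) (phi : {ffun H -> T}).

Definition compatible (e : {set H}) (g : {ffun H -> {set bit}}) :=
  [forall x in e, forall y in e,
     g x :&: block (inl (phi @: e)) == g y :&: block (inl (phi @: e))].

Definition lifts : {set {ffun H -> {set bit}}} :=
  [set g : {ffun H -> {set bit}} | [forall x, g x :&: block (inr (phi x)) == set0] &&
           [forall e in edges H, compatible e g]].

Lemma compatible2 x y g : compatible [set x; y] g =
  (g x :&: block (inl [set phi x; phi y]) == g y :&: block (inl [set phi x; phi y])).
Proof.
rewrite /compatible imsetU1 imset_set1.
apply/forall_inP/eqP => [/(_ x)|E u].
  by rewrite !inE eqxx => /(_ isT)/forall_inP/(_ y); rewrite !inE eqxx orbT => /(_ isT)/eqP.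
by rewrite !inE => /orP[]/eqP->; apply/forall_inP=> v;
  rewrite !inE => /orP[]/eqP->; rewrite ?E.
Qed.

(** On a forest the vertex and edge constraints are independent: the uniform law on [lifts] is a
    Markov random field, and its total mass 1 gives their number. *)
Lemma card_lifts : is_forest H -> phi \in homs H T ->
  (#|lifts| * 2 ^ cost phi = 2 ^ (#|bit| * nv H))%N.
Proof.
move=> forH hphi.
(* [P x] is the uniform law on the sets that avoid the vertex block; [rho e] is the indicator of
   compatibility divided by its probability. *)
pose P x (a : {set bit}) : rat :=
  (a :&: block (inr (phi x)) == set0)%:R * (2 ^ m (inr (phi x)))%:R / (2 ^ #|bit|)%:R.
pose rho (e : {set H}) g : rat := (compatible e g)%:R * (2 ^ m (inl (phi @: e)))%:R.
have regroup (a b c d k : rat) : a * c / k * (b * d) = a * b * (c * d / k) by ring.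
have pow_neq0 n : (2 ^ n)%:R != 0 :> rat by rewrite pnatr_eq0 expn_eq0.
have P_sum x : \sum_a P x a = 1.
  rewrite -mulr_suml -mulr_suml -natr_sum -big_mkcond sum1dep_card -natrM.
  have := @card_prescribed bit (block (inr (phi x))) set0 set0.
  rewrite -setI_eq0 setI0 eqxx => /(_ isT); rewrite cards0 addn0 card_block.
  have -> : [set a : {set bit} | (a :&: block (inr (phi x)) == set0) &&
      (a :&: set0 == set0 :&: set0)] = [set a | a :&: block (inr (phi x)) == set0].
    by apply/setP=> a; rewrite !inE !setI0 eqxx andbT.
  by move=> ->; rewrite divff.
have rho_local e : e \in edges H -> depends_only_on e (rho e).
  move=> _ f g fg; rewrite /rho; suff -> : compatible e f = compatible e g by [].
  apply: eq_forallb => x; have [xe /=|//] := boolP (x \in e).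
  by apply: eq_forallb => y; have [ye /=|//] := boolP (y \in e); rewrite !fg.
have rho_sum x y (f : {ffun H -> {set bit}}) : adj x y -> P y (f y) != 0 ->
    \sum_a P x a * rho [set x; y] (upd f x a) = 1.
  move=> xy _; pose e := [set phi x; phi y].
  have Erho a : rho [set x; y] (upd f x a) =
      (a :&: block (inl e) == f y :&: block (inl e))%:R * (2 ^ m (inl e))%:R.
    rewrite /rho compatible2 upd_same upd_other 1?eq_sym ?adj_neq //.
    by rewrite imsetU1 imset_set1.
  pose Q (a : {set bit}) := (a :&: block (inr (phi x)) == set0) &&
    (a :&: block (inl e) == f y :&: block (inl e)).
  transitivity (\sum_a (Q a)%:R *
    ((2 ^ m (inr (phi x)) * 2 ^ m (inl e))%:R / (2 ^ #|bit|)%:R) : rat).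
    by apply: eq_bigr => a _; rewrite Erho /P /Q -mulnb !natrM regroup.
  rewrite -mulr_suml mulrA -natr_sum -big_mkcond sum1dep_card -natrM.
  (* Avoiding the vertex block and copying [f y] on the edge block fix disjoint sets of bits. *)
  have := @card_prescribed bit (block (inr (phi x))) (block (inl e)) (f y).
  by rewrite block_disjoint // => /(_ isT); rewrite !card_block expnD => ->; rewrite divff.
have fieldE g : markov_field P rho setT g =
    (g \in lifts)%:R * ((2 ^ cost phi)%:R / (2 ^ (#|bit| * nv H))%:R).
  rewrite /markov_field /P /rho !big_split /= !prod_natr_bool -!natr_prod -!expn_sum.
  rewrite prodr_const cardsT exprVn -natrX -expnM /cost expnD natrM.
  rewrite inE -mulnb natrM.
  have -> : edges_in setT = edges H by apply/setP=> e; rewrite inE subsetT andbT.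
  have -> : [forall x in setT, g x :&: block (inr (phi x)) == set0] =
            [forall x, g x :&: block (inr (phi x)) == set0].
    by apply: eq_forallb => x; rewrite inE.
  have -> : (\sum_(x in setT) m (inr (phi x)) = \sum_x m (inr (phi x)))%N.
    by apply: eq_bigl => x; rewrite inE.
  by rewrite regroup.
have := expect_cst forH P_sum rho_local rho_sum setT [ffun=> set0] 1.
rewrite /expect (eq_bigl xpredT) => [|g]; last first.
  by apply/forallP=> x; rewrite inE.
under eq_bigr do rewrite fieldE mulr1.
rewrite -mulr_suml -natr_sum -big_mkcond sum1_card mulrA -natrM => /divr1_eq/eqP.
by rewrite eqr_nat => /eqP.
Qed.
End Lifts.

(** The homomorphisms over the identity of [T] already suffice for the lower bound on the density of
    [T]. *)
Lemma leq_lifts_homs_blowup : (#|@lifts T [ffun v => v]| <= #|homs T blowup|)%N.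
Proof.
pose pr (g : {ffun T -> {set bit}}) : {ffun T -> blowup} := [ffun v => (v, g v) : blowup].
rewrite -(card_imset _ (f := pr)); last first.
  by move=> g h /ffunP E; apply/ffunP=> v; have := E v; rewrite !ffunE => -[].
apply/subset_leq_card/subsetP=> h /imsetP[g].
rewrite inE => /andP[/forallP gx /forall_inP ge] ->.
apply/homsP=> u v uv; rewrite !ffunE /= /blow_adj /= uv.
move: (gx u) (gx v); rewrite !ffunE => -> -> /=.
by have := ge _ (mem_edges uv); rewrite compatible2 !ffunE.
Qed.

(** A homomorphism to the blow-up is determined by its projection [phi] to [T] and its bits, and the
    bits form a lift of [phi]. *)
Lemma card_homs_blowup (H : sgraph) : no_isolated H ->
  (#|homs H blowup| <= \sum_(phi in homs H T) #|lifts phi|)%N.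
Proof.
move=> isoH.
pose base (f : {ffun H -> blowup}) : {ffun H -> T} := [ffun x => (f x).1].
pose bits (f : {ffun H -> blowup}) : {ffun H -> {set bit}} := [ffun x => (f x).2].
have fadj f x y : f \in homs H blowup -> adj x y -> blow_adj (f x) (f y).
  by move=> /homsP/(_ x y); apply.
have bhom f : f \in homs H blowup -> base f \in homs H T.
  by move=> fh; apply/homsP=> x y xy; rewrite !ffunE; case/andP: (fadj f x y fh xy).
rewrite -sum1_card (partition_big base (mem (homs H T))) //=.
apply: leq_sum => phi hphi; rewrite sum1dep_card -(card_in_imset (f := bits)); last first.
  move=> f g; rewrite !inE => /andP[_ /eqP fp] /andP[_ /eqP gp] /ffunP E.
  apply/ffunP=> x; have := E x; rewrite !ffunE => E2.
  have : base f x = base g x by rewrite fp gp.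
  by rewrite !ffunE => E1; rewrite [f x]surjective_pairing E1 E2 -surjective_pairing.
apply/subset_leq_card/subsetP=> h /imsetP[f]; rewrite inE => /andP[fh /eqP Ephi] ->.
rewrite inE -Ephi; apply/andP; split.
  (* Avoiding the vertex block is part of adjacency, so it is read off from a neighbour [y] of
     [x]. *)
  apply/forallP=> x; have [y xy] := isoH x.
  by rewrite !ffunE; case/and4P: (fadj f x y fh xy).
apply/forall_inP=> _ /edgesP[x [y [xy ->]]].
by rewrite compatible2 !ffunE; case/and4P: (fadj f x y fh xy).
Qed.

End Blowup.

(** * Entropy *)

Section Gibbs.
Variables (R : realType) (X : finType).
Implicit Types (D : {set X}) (q : X -> R).

Lemma ln_le_subr1 (x : R) : 0 < x -> ln x <= x - 1.
Proof.
by move=> x0; rewrite -{1}(subrKC 1 x); apply: le_ln1Dx; lra.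
Qed.

Lemma ln_prod (D : {pred X}) (F : X -> R) : (forall i, i \in D -> 0 < F i) ->
  ln (\prod_(i in D) F i) = \sum_(i in D) ln (F i).
Proof.
move=> F0.
suff [] : 0 < \prod_(i in D) F i /\ ln (\prod_(i in D) F i) = \sum_(i in D) ln (F i) by [].
apply: (big_rec2 (fun x y => 0 < x /\ ln x = y)) => [|i x y iD [x0 <-]].
  by rewrite ln1 ltr01.
by rewrite mulr_gt0 ?lnM ?posrE ?F0.
Qed.

Lemma sum1_card_gt0 D q : \sum_(x in D) q x = 1 -> (0 < #|D|)%N.
Proof.
move=> q1; rewrite card_gt0; apply/eqP=> D0; move: q1.
by rewrite D0 big_set0 => /eqP; rewrite eq_sym oner_eq0.
Qed.

(** Gibbs' inequality against the uniform law on [D], from [ln t <= t - 1] at [t = (q x * n)^-1]. *)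
Lemma entropy_le_ln_card D q : (forall x, x \in D -> 0 <= q x) ->
  \sum_(x in D) q x = 1 -> - \sum_(x in D) q x * ln (q x) <= ln #|D|%:R.
Proof.
move=> q0 q1; have D0 := sum1_card_gt0 q1.
set n : R := #|D|%:R; have n0 : 0 < n by rewrite ltr0n.
suff : \sum_(x in D) (- (q x * ln (q x)) - q x * ln n) <= \sum_(x in D) (n^-1 - q x).
  rewrite !big_split /= !sumrN -mulr_suml q1 sumr_const -[n^-1 *+ _]mulr_natl.
  rewrite -/n divff ?gt_eqF //.
  lra.
apply: ler_sum => x xD; have [->|qx] := eqVneq (q x) 0.
  by rewrite !mul0r !subr0 oppr0 invr_ge0 ltW.
have {}qx : 0 < q x by rewrite lt0r qx q0.
have qn := mulr_gt0 qx n0.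
have := @ln_le_subr1 (q x * n)^-1; rewrite invr_gt0 qn => /(_ isT).
rewrite lnV ?posrE ?mulr_gt0 // lnM ?posrE // => /(ler_wpM2l (ltW qx)).
have -> : q x * ((q x * n)^-1 - 1) = n^-1 - q x by field; rewrite !gt_eqF.
lra.
Qed.

(** Gibbs' inequality with the roles reversed: the uniform law on [D] against a sub-probability
    [q]. *)
Lemma sum_ln_le D q : (0 < #|D|)%N -> (forall x, x \in D -> 0 < q x) ->
  \sum_(x in D) q x <= 1 ->
  \sum_(x in D) ln (q x) <= - (#|D|%:R * ln #|D|%:R).
Proof.
move=> D0 q0 q1; set n : R := #|D|%:R; have n0 : 0 < n by rewrite ltr0n.
suff : \sum_(x in D) (ln (q x) + ln n) <= \sum_(x in D) (n * q x - 1).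
  have := ler_wpM2l (ltW n0) q1.
  rewrite !big_split /= !sumr_const -[ln n *+ _]mulr_natl -[- 1 *+ _]mulr_natl.
  rewrite -mulr_sumr -/n; clearbody n; lra.
apply: ler_sum => x /q0 qx; rewrite addrC -lnM ?posrE //.
by apply: ln_le_subr1; rewrite mulr_gt0.
Qed.

End Gibbs.

(** * Entropy and mutual information of a uniformly random homomorphism *)

Section Entropy.
Variables (R : realType) (T G : sgraph).
Hypothesis homs_gt0 : (0 < #|homs T G|)%N.

Definition avg (F : {ffun T -> G} -> R) : R :=
  (\sum_(psi in homs T G) F psi) / #|homs T G|%:R.

Definition vprob v a := avg (fun psi => (psi v == a)%:R).

Definition ventropy v := - avg (fun psi => ln (vprob v (psi v))).

Definition eprob (e : {set T}) (chi : {ffun T -> G}) :=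
  avg (fun psi => [forall v in e, psi v == chi v]%:R).

Definition mutual_info (e : {set T}) :=
  avg (fun psi => ln (eprob e psi / \prod_(v in e) vprob v (psi v))).

Lemma avg_cst c : avg (fun=> c) = c.
Proof. by rewrite /avg sumr_const -[c *+ _]mulr_natr mulfK // pnatr_eq0 -lt0n. Qed.

Lemma eq_avg F1 F2 : (forall psi, psi \in homs T G -> F1 psi = F2 psi) ->
  avg F1 = avg F2.
Proof. by move=> F12; congr (_ / _); apply: eq_bigr. Qed.

Lemma avg_sum (I : Type) (r : seq I) (Q : pred I) (F : I -> {ffun T -> G} -> R) :
  \sum_(i <- r | Q i) avg (F i) = avg (fun psi => \sum_(i <- r | Q i) F i psi).
Proof. by rewrite /avg exchange_big mulr_suml. Qed.

Lemma avgMr F c : avg F * c = avg (fun psi => F psi * c).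
Proof. by rewrite /avg -mulr_suml mulrAC. Qed.

Lemma avg_bool_ge0 b : 0 <= avg (fun psi => (b psi)%:R).
Proof. by rewrite divr_ge0 ?ler0n // sumr_ge0 // => psi _; rewrite ler0n. Qed.

Lemma avg_bool_gt0 (b : pred {ffun T -> G}) psi : psi \in homs T G -> b psi ->
  0 < avg (fun psi => (b psi)%:R).
Proof.
move=> hpsi bpsi; rewrite divr_gt0 ?ltr0n // (bigD1 psi) //= bpsi.
by rewrite ltr_wpDr // sumr_ge0 // => chi _; rewrite ler0n.
Qed.

Lemma avg_bool_neq0 (b : pred {ffun T -> G}) :
  avg (fun psi => (b psi)%:R) != 0 -> exists2 psi, psi \in homs T G & b psi.
Proof.
move=> bn0; apply/exists_inP; apply: contraNT bn0 => /exists_inPn bF.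
by rewrite /avg big1 ?mul0r // => psi /bF/negbTE->.
Qed.

Lemma vprob_gt0 psi v : psi \in homs T G -> 0 < vprob v (psi v).
Proof. by move=> hpsi; apply: avg_bool_gt0 hpsi _; rewrite eqxx. Qed.

Lemma eprob_gt0 psi e : psi \in homs T G -> 0 < eprob e psi.
Proof. by move=> hpsi; apply: avg_bool_gt0 hpsi _; apply/forall_inP. Qed.

Lemma sum_vprob v (F : G -> R) : \sum_a vprob v a * F a = avg (fun psi => F (psi v)).
Proof.
rewrite /vprob; under eq_bigr do rewrite avgMr; rewrite avg_sum; apply: eq_avg => psi _.
rewrite (bigD1 (psi v)) //= eqxx mul1r big1 ?addr0 // => a.
by rewrite eq_sym => /negbTE->; rewrite mul0r.
Qed.

Lemma ventropy_le v : ventropy v <= ln (nv G)%:R.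
Proof.
rewrite /ventropy -(sum_vprob v (fun a => ln (vprob v a))) /nv -cardsT.
have E F : \sum_a F a = \sum_(a in [set: G]) F a :> R.
  by apply: eq_bigl => a; rewrite inE.
rewrite E; apply: entropy_le_ln_card => [a _|]; first exact: avg_bool_ge0.
rewrite -E -[RHS](avg_cst 1) -(sum_vprob v (fun=> 1)).
by apply: eq_bigr => a _; rewrite mulr1.
Qed.

(** * The Markov random field on [H] induced by a homomorphism to [T] *)

Section Pullback.
Variables (H : sgraph) (phi : {ffun H -> T}).
Hypotheses (H_forest : is_forest H) (phi_hom : phi \in homs H T).

Definition pull (psi : {ffun T -> G}) : {ffun H -> G} := [ffun x => psi (phi x)].

Definition pull_vprob x a := vprob (phi x) a.

(** [f] need not factor through [phi], so the event is stated on [e] and not on [phi @: e]; the two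
    agree when [f] is a pullback. *)
Definition pull_eprob (e : {set H}) (f : {ffun H -> G}) :=
  avg (fun psi => [forall x in e, pull psi x == f x]%:R).

Definition pull_density e f := pull_eprob e f / \prod_(x in e) pull_vprob x (f x).

Lemma pull_eprob_neq0 e f : pull_eprob e f != 0 ->
  exists2 psi, psi \in homs T G & forall x, x \in e -> f x = pull psi x.
Proof.
move=> /avg_bool_neq0[psi hpsi /forall_inP E]; exists psi => // x /E/eqP.
by [].
Qed.

Lemma pull_eprobE x y f : pull_eprob [set x; y] f =
  avg (fun psi => ((psi (phi x) == f x) && (psi (phi y) == f y))%:R).
Proof.
apply: eq_avg => psi _; congr ((nat_of_bool _)%:R); apply/forall_inP/andP => [E|[Ex Ey] z].
  by have := E x; have := E y; rewrite !ffunE !inE !eqxx orbT => -> // ->.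
by rewrite !inE => /orP[]/eqP->; rewrite ffunE.
Qed.

(** Where the joint probability is nonzero both marginals are positive and cancel; elsewhere both
    sides are 0. *)
Lemma pull_densityM x y (f : {ffun H -> G}) : adj x y ->
  pull_vprob x (f x) * pull_vprob y (f y) * pull_density [set x; y] f = pull_eprob [set x; y] f.
Proof.
move=> xy; rewrite /pull_density big_setU1 ?inE ?adj_neq //= big_set1.
have [->|/pull_eprob_neq0[psi hpsi E]] := eqVneq (pull_eprob [set x; y] f) 0.
  by rewrite mul0r mulr0.
rewrite mulrC divfK // !E ?inE ?eqxx ?orbT // !ffunE.
by rewrite mulf_neq0 // gt_eqF // vprob_gt0.
Qed.

Lemma pull_vprob_sum x : \sum_a pull_vprob x a = 1.
Proof.
rewrite -[RHS](avg_cst 1) -(sum_vprob (phi x) (fun=> 1)).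
by apply: eq_bigr => a _; rewrite mulr1.
Qed.

Lemma pull_density_local e : e \in edges H -> depends_only_on e (pull_density e).
Proof.
move=> _ f g fg; congr (_ / _); last by apply: eq_bigr => x xe; rewrite fg.
apply: eq_avg => psi _; congr ((nat_of_bool _)%:R).
by apply: eq_forallb => x; have [xe /=|//] := boolP (x \in e); rewrite fg.
Qed.

(** After multiplication by the marginal at [y], this sums the joint law over the value at [x]. *)
Lemma pull_density_sum x y (f : {ffun H -> G}) : adj x y -> pull_vprob y (f y) != 0 ->
  \sum_a pull_vprob x a * pull_density [set x; y] (upd f x a) = 1.
Proof.
move=> xy Py; apply: (mulIf Py); rewrite mul1r mulr_suml.
have yx : y != x by rewrite eq_sym adj_neq.
transitivity (\sum_a pull_eprob [set x; y] (upd f x a)).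
  apply: eq_bigr => a _; rewrite -pull_densityM // upd_same upd_other //.
  by rewrite mulrAC.
under eq_bigr do rewrite pull_eprobE; rewrite avg_sum; apply: eq_avg => psi _.
rewrite (bigD1 (psi (phi x))) //= upd_same upd_other // eqxx /= big1 ?addr0 // => a.
by rewrite eq_sym upd_same => /negbTE->.
Qed.

Definition law := markov_field pull_vprob pull_density setT.

Lemma sum_law (F : {ffun H -> G} -> R) f0 :
  \sum_f law f * F f = expect pull_vprob pull_density setT f0 F.
Proof.
apply: eq_bigl => f; apply/esym/forallP=> x; by rewrite inE.
Qed.

Let psi0 : {ffun T -> G} := sval (sigW (card_gt0P homs_gt0)).

Lemma sum_law1 : \sum_f law f = 1.
Proof.
rewrite -(expect_cst H_forest pull_vprob_sum pull_density_local
  pull_density_sum setT (pull psi0) 1) -sum_law.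
by apply: eq_bigr => f _; rewrite mulr1.
Qed.

Lemma sum_law_vertex x (F : G -> R) :
  \sum_f law f * F (f x) = avg (fun psi => F (psi (phi x))).
Proof.
rewrite (sum_law (fun f => F (f x)) (pull psi0)).
rewrite (expect1 H_forest pull_vprob_sum pull_density_local pull_density_sum _ (z := x)).
- by rewrite -sum_vprob; apply: eq_bigr => a _; rewrite upd_same.
- by rewrite inE.
- by move=> f g fg; rewrite fg ?inE.
Qed.

(** [pull_densityM] turns the weights of [expect2] into the joint probabilities of the ends under
    psi o phi. *)
Lemma sum_law_edge e (F : {ffun H -> G} -> R) : e \in edges H -> depends_only_on e F ->
  \sum_f law f * F f = avg (fun psi => F (pull psi)).
Proof.
move=> /edgesP[x [y [xy ->]]] locF; rewrite (sum_law _ (pull psi0)).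
have xny := adj_neq xy.
have ynx : y != x by rewrite eq_sym.
rewrite (expect2 H_forest pull_vprob_sum pull_density_local pull_density_sum _ _ _ xy) ?inE //.
transitivity (\sum_a \sum_b avg (fun psi =>
   ((psi (phi x) == a) && (psi (phi y) == b))%:R * F (upd (upd (pull psi0) x a) y b))).
  apply: eq_bigr => a _; apply: eq_bigr => b _.
  set g := upd (upd _ x a) y b.
  have gx : g x = a by rewrite /g upd_other // upd_same.
  have gy : g y = b by rewrite /g upd_same.
  by rewrite -{1}gx -{1}gy pull_densityM // pull_eprobE gx gy avgMr.
under eq_bigr do rewrite avg_sum; rewrite avg_sum; apply: eq_avg => psi _.
rewrite (bigD1 (psi (phi x))) //= [X in _ + X]big1 ?addr0; last first.
  by move=> a /negbTE ax; apply: big1 => b _; rewrite eq_sym ax mul0r.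
rewrite (bigD1 (psi (phi y))) //= [X in _ + X]big1 ?addr0; last first.
  by move=> b /negbTE bx; rewrite [_ == b]eq_sym bx andbF mul0r.
rewrite !eqxx mul1r; apply: locF => z; rewrite !inE => /orP[]/eqP->.
  by rewrite upd_other // upd_same ffunE.
by rewrite upd_same ffunE.
Qed.

Lemma pull_density_ge0 e f : 0 <= pull_density e f.
Proof.
by rewrite divr_ge0 ?avg_bool_ge0 // prodr_ge0 // => x _; apply: avg_bool_ge0.
Qed.

Lemma law_ge0 f : 0 <= law f.
Proof.
rewrite mulr_ge0 // prodr_ge0 // => [x _|e _]; first exact: avg_bool_ge0.
exact: pull_density_ge0.
Qed.

(** A nonzero edge density means that [f] coincides on the edge with [pull psi] for some
    homomorphism [psi]. *)
Lemma law_homs f : law f != 0 -> f \in homs H G.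
Proof.
move=> qf; apply/homsP=> x y xy.
have : pull_density [set x; y] f != 0.
  by apply: field_supp_edge qf _; rewrite inE subsetT mem_edges.
rewrite mulf_eq0 negb_or => /andP[/pull_eprob_neq0[psi /homsP hpsi E] _].
rewrite !E ?inE ?eqxx ?orbT // !ffunE; apply: hpsi; exact: (homsP _ phi_hom).
Qed.

Lemma edges_inT : edges_in [set: H] = edges H.
Proof. by apply/setP=> e; rewrite inE subsetT andbT. Qed.

Lemma ln_law f : law f != 0 -> ln (law f) =
  \sum_x ln (pull_vprob x (f x)) + \sum_(e in edges H) ln (pull_density e f).
Proof.
move=> qf.
have Px x : 0 < pull_vprob x (f x).
  by rewrite lt0r avg_bool_ge0 andbT; apply: field_supp qf _; rewrite inE.
have re e : e \in edges H -> 0 < pull_density e f.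
  move=> eE; rewrite lt0r pull_density_ge0 andbT.
  by apply: field_supp_edge qf _; rewrite edges_inT.
have := qf; rewrite /law /markov_field edges_inT mulf_eq0 negb_or => /andP[].
rewrite lnM ?posrE ?prodr_gt0 // => _ _; rewrite !ln_prod //.
by congr (_ + _); apply: eq_bigl => x; rewrite inE.
Qed.

Lemma pull_density_pull e psi : psi \in homs T G -> e \in edges H ->
  pull_density e (pull psi) =
  eprob (phi @: e) psi / \prod_(v in phi @: e) vprob v (psi v).
Proof.
move=> hpsi eE; congr (_ / _).
  apply: eq_avg => chi _; congr ((nat_of_bool _)%:R).
  apply/forall_inP/forall_inP => [E v /imsetP[x xe ->]|E x xe].
    by have := E x xe; rewrite !ffunE.
  by rewrite !ffunE; apply: E; apply: imset_f.
rewrite big_imset /=; last exact: hom_edge_inj phi_hom eE.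
by apply: eq_bigr => x _; rewrite ffunE.
Qed.

(** The entropy of [law] is at most the logarithm of the number of homomorphisms, on which it is
    supported. By [ln_law] it splits over vertices and edges, where the marginals are those of psi o
    phi. *)
Lemma ln_card_homs_ge :
  \sum_x ventropy (phi x) - \sum_(e in edges H) mutual_info (phi @: e) <=
  ln #|homs H G|%:R.
Proof.
have law_out f : f \notin homs H G -> law f = 0.
  by apply: contraNeq; apply: law_homs.
have restrict F : \sum_(f in homs H G) law f * F f = \sum_f law f * F f.
  rewrite [RHS](bigID (mem (homs H G))) /= [X in _ + X]big1 ?addr0 // => f hf.
  by rewrite law_out ?mul0r.
have := @entropy_le_ln_card R _ (homs H G) law (fun f _ => law_ge0 f).
have -> : \sum_(f in homs H G) law f = 1.
  rewrite -sum_law1 -[RHS](eq_bigr _ (fun f _ => mulr1 (law f))) -restrict.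
  by apply: eq_bigr => f _; rewrite mulr1.
move=> /(_ erefl); apply: le_trans; rewrite restrict.
have -> : \sum_f law f * ln (law f) = \sum_f law f *
   (\sum_x ln (pull_vprob x (f x)) + \sum_(e in edges H) ln (pull_density e f)).
  by apply: eq_bigr => f _; have [->|/ln_law->//] := eqVneq (law f) 0; rewrite !mul0r.
under [X in _ <= - X]eq_bigr do rewrite mulrDr !mulr_sumr.
rewrite big_split /= opprD exchange_big [X in _ - X]exchange_big /=.
apply: lerB; rewrite -?sumrN; apply: ler_sum.
  by move=> x _; rewrite (sum_law_vertex x (fun a => ln (pull_vprob x a))).
move=> e eE; rewrite (sum_law_edge eE (F := fun f => ln (pull_density e f))).
  rewrite le_eqVlt; apply/orP; left; apply/eqP.
  by apply: eq_avg => psi hpsi; rewrite pull_density_pull.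
by move=> f g fg; rewrite (pull_density_local eE fg).
Qed.

End Pullback.

Lemma id_homs : [ffun v => v] \in homs T T.
Proof. by apply/homsP=> u v; rewrite !ffunE. Qed.

(** This is [sum_ln_le] for the field [q] of the identity, whose mass on [homs T G] is at most 1;
    the average of [ln (q psi)] is minus the right-hand side. *)
Lemma ln_card_homs_le : is_forest T -> ln #|homs T G|%:R <=
  \sum_v ventropy v - \sum_(e in edges T) mutual_info e.
Proof.
move=> T_forest; pose q := law [ffun v : T => v].
have pullE psi : pull [ffun v => v] psi = psi by apply/ffunP=> v; rewrite !ffunE.
have imE (e : {set T}) : [ffun v => v] @: e = e.
  by rewrite -[RHS]imset_id; apply: eq_imset => v; rewrite ffunE.
have dE psi e : psi \in homs T G -> e \in edges T -> pull_density [ffun v => v] e psi =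
    eprob e psi / \prod_(v in e) vprob v (psi v).
  by move=> hpsi eE; rewrite -{1}(pullE psi) pull_density_pull ?id_homs ?imE.
have q_gt0 psi : psi \in homs T G -> 0 < q psi.
  move=> hpsi; rewrite mulr_gt0 ?prodr_gt0 // => [v _|e].
    by rewrite /pull_vprob ffunE vprob_gt0.
  rewrite edges_inT => eE; rewrite dE // divr_gt0 ?eprob_gt0 //.
  by rewrite prodr_gt0 // => v _; rewrite vprob_gt0.
have /(sum_ln_le homs_gt0 q_gt0) : \sum_(psi in homs T G) q psi <= 1.
  rewrite -(sum_law1 [ffun v : T => v] T_forest) [leRHS](bigID (mem (homs T G))) /=.
  by rewrite lerDl sumr_ge0 // => f _; apply: law_ge0.
have M0 : 0 < #|homs T G|%:R :> R by rewrite ltr0n.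
have -> : \sum_(psi in homs T G) ln (q psi) = #|homs T G|%:R *
    (- \sum_v ventropy v + \sum_(e in edges T) mutual_info e).
  rewrite mulrC -[LHS](divfK (lt0r_neq0 M0)) -sumrN; congr (_ * _).
  under [X in _ = X + _]eq_bigr do rewrite opprK.
  rewrite !avg_sum /avg -mulrDl -big_split /=; congr (_ / _).
  apply: eq_bigr => psi hpsi; rewrite ln_law ?gt_eqF ?q_gt0 //; congr (_ + _).
    by apply: eq_bigr => v _; rewrite /pull_vprob ffunE.
  by apply: eq_bigr => e eE; rewrite dE.
by rewrite -mulrN ler_pM2l //; lra.
Qed.

End Entropy.

(** * The linear program *)

Lemma sum_mu_edge (R : pzSemiRingType) (H T : sgraph) (phi : {ffun H -> T})
    (F : {set T} -> R) : phi \in homs H T ->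
  \sum_(e in edges T) (mu_edge phi e)%:R * F e = \sum_(d in edges H) F (phi @: d).
Proof.
move=> hphi.
rewrite (partition_big (fun d : {set H} => phi @: d) (mem (edges T))) /=; last first.
  by move=> d; apply: hom_edge.
apply: eq_bigr => e _; rewrite (eq_bigr (fun=> F e)); last by move=> d /andP[_ /eqP->].
by rewrite sumr_const mulr_natl /mu_edge cardsE.
Qed.

Lemma sum_mu_vertex (R : pzSemiRingType) (H T : sgraph) (phi : {ffun H -> T})
    (F : T -> R) :
  \sum_v (mu_vertex phi v)%:R * F v = \sum_x F (phi x).
Proof.
rewrite (partition_big phi xpredT) //=; apply: eq_bigr => v _.
rewrite (eq_bigr (fun=> F v)); last by move=> x /eqP->.
by rewrite sumr_const mulr_natl /mu_vertex cardsE.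
Qed.

Lemma sum_mu_edge1 (R : pzSemiRingType) (H T : sgraph) (phi : {ffun H -> T}) :
  phi \in homs H T -> \sum_(e in edges T) (mu_edge phi e)%:R = (ne H)%:R :> R.
Proof.
move=> hphi; rewrite -[RHS]sumr_const -(sum_mu_edge (fun=> 1) hphi).
by apply: eq_bigr => e _; rewrite mulr1.
Qed.

Lemma natr_cost (R : pzSemiRingType) (H T : sgraph) (phi : {ffun H -> T}) m :
  phi \in homs H T -> (cost m phi)%:R =
    \sum_v (mu_vertex phi v)%:R * (m (inr v))%:R +
    \sum_(e in edges T) (mu_edge phi e)%:R * (m (inl e))%:R :> R.
Proof.
move=> hphi.
by rewrite (sum_mu_vertex phi (fun v => _%:R)) (sum_mu_edge (fun e => _%:R)) // natrD !natr_sum.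
Qed.

Lemma cost_id (T : sgraph) m : cost m [ffun v : T => v] =
  (\sum_v m (inr v) + \sum_(e in edges T) m (inl e))%N.
Proof.
congr (_ + _)%N; first by apply: eq_bigr => v _; rewrite ffunE.
apply: eq_bigr => e _; congr (m (inl _)).
by rewrite -[RHS]imset_id; apply: eq_imset => v; rewrite ffunE.
Qed.

(** [D] is the product of all denominators. *)
Lemma clear_denominators (I : finType) (nu : I -> rat) : (forall i, 0 < nu i) ->
  exists m : I -> nat, exists2 D : rat, 0 < D & forall i, (m i)%:R = D * nu i.
Proof.
move=> nu0; exists (fun i => `|numq (nu i)| * \prod_(j | j != i) `|denq (nu j)|)%N.
exists (\prod_j (`|denq (nu j)|%N)%:R).
  by apply: prodr_gt0 => j _; rewrite ltr0n absz_gt0 denq_neq0.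
move=> i; rewrite natrM natr_prod [in RHS](bigD1 i) //= [RHS]mulrAC; congr (_ * _).
rewrite !pmulrn !gez0_abs; first by rewrite numqE mulrC.
  exact: denq_ge0.
by rewrite ltW // numq_gt0.
Qed.

(* Up to scaling, a solution of the dual program of value less than [ne T]. *)
Definition dual_weights (H T : sgraph) (m : {set T} + T -> nat) :=
  forall phi, phi \in homs H T ->
    (ne H * cost m [ffun v : T => v] < ne T * cost m phi)%N.

(* Up to scaling, [la] is a solution of the program with objective [ne T]. *)
Lemma tight_or_dual (H T : sgraph) :
  (exists2 la : {ffun H -> T} -> rat,
     (forall phi, 0 <= la phi) /\ 0 < \sum_(phi in homs H T) la phi &
     (forall e, e \in edges T ->
       (ne T)%:R * \sum_(phi in homs H T) (mu_edge phi e)%:R * la phi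
         <= (ne H)%:R * \sum_(phi in homs H T) la phi) /\
     (forall v, (ne T)%:R * \sum_(phi in homs H T) (mu_vertex phi v)%:R * la phi
         <= (ne H)%:R * \sum_(phi in homs H T) la phi)) \/
  exists m : {set T} + T -> nat, dual_weights H m.
Proof.
(* Pairing row [phi] with weights gives [ne T] times the cost of [phi] minus [ne H] times the cost
   of the identity; sets that are not edges contribute 0. *)
pose A (phi : {ffun H -> T}) (i : {set T} + T) : rat := match i with
  | inl e => if e \in edges T then (ne T)%:R * (mu_edge phi e)%:R - (ne H)%:R else 0
  | inr v => (ne T)%:R * (mu_vertex phi v)%:R - (ne H)%:R end.
have [[nu nu0 Anu]|[la [la0 lap] lai]] := ville (homs H T) A.
  right; have [m [D D0 mD]] := clear_denominators nu0.
  exists m => phi hphi; rewrite -(ltr_nat rat) !natrM cost_id (natr_cost _ _ hphi) natrD !natr_sum.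
  rewrite -subr_gt0; have := mulr_gt0 D0 (Anu phi hphi).
  rewrite big_sumType /= mulrDr !mulr_sumr addrC.
  congr (0 < _); rewrite !mulrDr !mulr_sumr opprD addrACA; congr (_ + _).
    rewrite -sumrN -big_split; apply: eq_bigr => v _ /=; rewrite mD; ring.
  rewrite -sumrN -big_split [RHS]big_mkcond; apply: eq_bigr => e _ /=.
  by case: ifP => _; rewrite ?mD; ring.
left; exists la => //; split=> [e eE|v].
  have := lai (inl e); rewrite /A eE => le0; rewrite -subr_le0; congr (_ <= _): le0.
  by rewrite !mulr_sumr -sumrB; apply: eq_bigr => phi _; ring.
have := lai (inr v); rewrite /A => le0; rewrite -subr_le0; congr (_ <= _): le0.
by rewrite !mulr_sumr -sumrB; apply: eq_bigr => phi _; ring.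
Qed.

(** * Tight solutions and weak duality *)

Section Tight.
Variables (R : realType) (H T : sgraph).
Hypotheses (H_nonempty : nonempty_graph H) (T_nonempty : nonempty_graph T).

Let neH0 : 0 < (ne H)%:R :> R. Proof. by rewrite ltr0n. Qed.
Let neT0 : 0 < (ne T)%:R :> R. Proof. by rewrite ltr0n. Qed.

(** The multiplicities of each [phi] over the edges of [T] add up to [ne H]. *)
Lemma lp_objectiveE (w : {ffun H -> T} -> R) :
  lp_objective w = (ne H)%:R * \sum_(phi in homs H T) w phi.
Proof.
rewrite /lp_objective exchange_big mulr_sumr; apply: eq_bigr => phi hphi.
by rewrite -mulr_suml sum_mu_edge1.
Qed.

Lemma lp_objective_le (w : {ffun H -> T} -> R) : lp_feasible w ->
  lp_objective w <= (ne T)%:R.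
Proof.
move=> [we _ _]; rewrite -[leRHS]sumr_const; exact: ler_sum.
Qed.

Lemma tight_solution (la : {ffun H -> T} -> rat) :
    (forall phi, 0 <= la phi) -> 0 < \sum_(phi in homs H T) la phi ->
    (forall e, e \in edges T ->
       (ne T)%:R * \sum_(phi in homs H T) (mu_edge phi e)%:R * la phi
         <= (ne H)%:R * \sum_(phi in homs H T) la phi) ->
    (forall v, (ne T)%:R * \sum_(phi in homs H T) (mu_vertex phi v)%:R * la phi
         <= (ne H)%:R * \sum_(phi in homs H T) la phi) ->
  exists2 w : {ffun H -> T} -> R, lp_feasible w & lp_objective w = (ne T)%:R.
Proof.
move=> la0; set L := \sum_(phi in _) la phi => L0 lae lav.
have LR0 : 0 < ratr L :> R by rewrite ltr0q.
(* Normalised so that [ne H] times the total mass of [w] is [ne T]. *)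
pose c : R := (ne T)%:R / ((ne H)%:R * ratr L).
have D0 : 0 < (ne H)%:R * ratr L :> R by exact: mulr_gt0.
have c0 : 0 < c by exact: divr_gt0.
pose w phi : R := c * ratr (la phi).
suff wf : lp_feasible w.
  exists w => //.
  rewrite lp_objectiveE -mulr_sumr -rmorph_sum -/L /c /=.
  by field; rewrite !gt_eqF // ltr0n.
have bound (mu : {ffun H -> T} -> nat) :
    (ne T)%:R * \sum_(phi in homs H T) (mu phi)%:R * la phi <= (ne H)%:R * L ->
    \sum_(phi in homs H T) (mu phi)%:R * (c * ratr (la phi)) <= 1 :> R.
  rewrite -(ler_rat R) !rmorphM /= !ratr_nat rmorph_sum /= => le.
  under eq_bigr do rewrite mulrCA.
  rewrite -mulr_sumr /c mulrAC ler_pdivrMr // mul1r.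
  apply: le_trans le; rewrite le_eqVlt; apply/orP; left; apply/eqP.
  by congr (_ * _); apply: eq_bigr => phi _; rewrite rmorphM /= ratr_nat.
split=> [e /lae/bound//|v|phi _]; first exact: bound (lav v).
by apply: mulr_ge0; rewrite ?ler0q ?la0 ?ltW.
Qed.

Lemma lp_value_tight (w : {ffun H -> T} -> R) : lp_feasible w ->
  lp_objective w = (ne T)%:R -> lp_value R H T = (ne T)%:R.
Proof.
move=> wf wT; apply/eqP; rewrite eq_le; apply/andP; split.
  apply: ge_sup; first by exists (lp_objective w), w.
  by move=> _ [u uf <-]; apply: lp_objective_le.
rewrite -{1}wT; apply: ub_le_sup; last by exists w.
by exists (ne T)%:R => _ [u uf <-]; apply: lp_objective_le.
Qed.

(** Each of the [ne T] edge sums is at most 1 and together they make [ne T], so none falls short. *)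
Lemma tight_edge (w : {ffun H -> T} -> R) e : lp_feasible w ->
  lp_objective w = (ne T)%:R -> e \in edges T ->
  \sum_(phi in homs H T) (mu_edge phi e)%:R * w phi = 1.
Proof.
move=> [we _ _] wT eE.
have sum0 : \sum_(e in edges T)
    (1 - \sum_(phi in homs H T) (mu_edge phi e)%:R * w phi) = 0.
  by rewrite sumrB -[X in _ - X]/(lp_objective w) wT sumr_const subrr.
apply/eqP; rewrite eq_sym -subr_eq0; apply/eqP.
by apply: (psumr_eq0P _ sum0) => // d dE; rewrite subr_ge0 we.
Qed.

Lemma dominates_tight (w : {ffun H -> T} -> R) : is_forest H -> is_forest T ->
  lp_feasible w -> lp_objective w = (ne T)%:R -> dominates H T.
Proof.
move=> forH forT wf wT G.
have [homs0|homs_gt0] := posnP #|homs T G|.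
  by rewrite {1}/homdens homs0 mul0r expr0n gtn_eqF // exprn_ge0 // divr_ge0 ?exprn_ge0 ?ler0n.
have tight e eE := @tight_edge w e wf wT eE.
have [_ wv w0] := wf.
set W := \sum_(phi in homs H T) w phi.
have WE : (ne H)%:R * W = (ne T)%:R by rewrite -lp_objectiveE.
have [psi hpsi] := card_gt0P homs_gt0.
have [phi hphi] : exists phi, phi \in homs H T.
  apply/set0Pn; apply/eqP=> h0; move: WE; rewrite /W h0 big_set0 mulr0 => /esym/eqP.
  by rewrite gt_eqF.
have homsH_gt0 : (0 < #|homs H G|)%N.
  apply/card_gt0P; exists [ffun x => psi (phi x)]; apply/homsP=> x y xy.
  by rewrite !ffunE; apply: (homsP _ hpsi); apply: (homsP _ hphi).
have nG0 : (0 < nv G)%N.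
  have [e /edgesP[v _]] := card_gt0P T_nonempty.
  by apply/card_gt0P; exists (psi v).
set n : R := (nv G)%:R; set N : R := #|homs H G|%:R; set M : R := #|homs T G|%:R.
have n0 : 0 < n by rewrite ltr0n.
have N0 : 0 < N by rewrite ltr0n.
have M0 : 0 < M by rewrite ltr0n.
pose h v := @ventropy R T G v.
pose mi e := @mutual_info R T G e.
(* The load of [w] at [v], at most 1 by feasibility. *)
pose mass v := \sum_(phi in homs H T) (mu_vertex phi v)%:R * w phi.
have leT : ln M <= \sum_v h v - \sum_(e in edges T) mi e by apply: ln_card_homs_le.
(* [ln_card_homs_ge] averaged with weights [w]; by tightness every mutual information gets
   coefficient exactly 1. *)
have leH : \sum_v mass v * h v - \sum_(e in edges T) mi e <= W * ln N.
  have -> : \sum_(e in edges T) mi e =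
      \sum_(phi in homs H T) w phi * \sum_(d in edges H) mi (phi @: d).
    under [RHS]eq_bigr => p hp do rewrite -(sum_mu_edge mi hp) mulr_sumr.
    rewrite exchange_big; apply: eq_bigr => e eE /=.
    rewrite -[LHS]mul1r -{1}(tight e eE) mulr_suml; apply: eq_bigr => p _; ring.
  have -> : \sum_v mass v * h v = \sum_(phi in homs H T) w phi * \sum_x h (phi x).
    under [RHS]eq_bigr => p hp do rewrite -(sum_mu_vertex p h) mulr_sumr.
    rewrite exchange_big; apply: eq_bigr => v _ /=.
    by rewrite mulr_suml; apply: eq_bigr => p _; ring.
  rewrite -sumrB /W mulr_suml; apply: ler_sum => p hp.
  by rewrite -mulrBr ler_wpM2l ?w0 // ln_card_homs_ge.
have massE : \sum_v mass v = W * (nv H)%:R.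
  rewrite exchange_big mulr_suml; apply: eq_bigr => p _ /=.
  rewrite -mulr_suml mulrC; congr (_ * _).
  transitivity (\sum_v (mu_vertex p v)%:R * 1 : R); first by under [RHS]eq_bigr do rewrite mulr1.
  by rewrite (sum_mu_vertex p (fun=> 1)) sumr_const.
have slack : \sum_v (1 - mass v) * h v <= \sum_v (1 - mass v) * ln n.
  by apply: ler_sum => v _; rewrite ler_wpM2l ?subr_ge0 ?wv // ventropy_le.
have lnle : ln M - (nv T)%:R * ln n <= W * (ln N - (nv H)%:R * ln n).
  move: slack; rewrite -mulr_suml sumrB massE sumr_const -/(nv T).
  under eq_bigr do rewrite mulrBl mul1r.
  rewrite sumrB; lra.
have densE (K : sgraph) : ratr (homdens K G) = #|homs K G|%:R / n ^+ nv K :> R.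
  by rewrite /homdens rmorphM /= fmorphV rmorphXn /= !ratr_nat.
have ln_dens (K : sgraph) j : (0 < #|homs K G|)%N ->
    ln ((#|homs K G|%:R / n ^+ nv K) ^+ j) = j%:R * (ln #|homs K G|%:R - (nv K)%:R * ln n).
  move=> K0; have K0R : 0 < #|homs K G|%:R :> R by rewrite ltr0n.
  rewrite lnXn ?divr_gt0 ?exprn_gt0 // ln_div ?posrE ?exprn_gt0 // lnXn //.
  by rewrite -[LHS]mulr_natl -[ln n *+ _]mulr_natl.
rewrite -(ler_rat R) !rmorphXn /= !densE -ler_ln ?posrE ?exprn_gt0 ?divr_gt0 ?exprn_gt0 //.
by rewrite !ln_dens // -WE -mulrA ler_pM2l.
Qed.

(** Weighting the constraints by [m] bounds the [w]-average of the costs by the cost of the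
    identity, while every single cost is too large for the objective to reach [ne T]. *)
Lemma lp_value_lt_dual (m : {set T} + T -> nat) : dual_weights H m ->
  lp_value R H T < (ne T)%:R.
Proof.
move=> dual; set c := cost m [ffun v => v]; pose cR : R := c%:R.
have c0 : 0 <= cR by rewrite ler0n.
(* The costs are integers, so the strict dual inequality has a gap of at least 1. This gap is
   uniform and survives the supremum. *)
pose D : R := (ne H)%:R * cR + 1.
have D0 : 0 < D by rewrite ltr_pwDr // mulr_ge0 // ltW.
apply: (@le_lt_trans _ _ ((ne T)%:R * ((ne H)%:R * cR) / D)); last first.
  by rewrite ltr_pdivrMr // ltr_pM2l // ltrDl.
apply: ge_sup.
  exists (lp_objective (fun _ : {ffun H -> T} => 0 : R)), (fun=> 0) => //.
  by split=> [e _|v|phi _] //; rewrite big1 // => phi _; rewrite mulr0.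
move=> _ [w [we wv w0] <-]; rewrite lp_objectiveE ler_pdivlMr //.
rewrite mulrCA -!mulrA ler_pM2l //.
have le1 : \sum_(phi in homs H T) w phi * (cost m phi)%:R <= cR.
  under eq_bigr => phi hphi do rewrite natr_cost // mulrDr !mulr_sumr.
  rewrite big_split /= exchange_big [X in _ + X]exchange_big /= /cR /c cost_id natrD !natr_sum.
  apply: lerD; apply: ler_sum; [move=> v _|move=> e eE].
    under eq_bigr do rewrite mulrA [w _ * _]mulrC.
    by rewrite -mulr_suml -[leRHS]mul1r ler_wpM2r ?ler0n.
  under eq_bigr do rewrite mulrA [w _ * _]mulrC.
  by rewrite -mulr_suml -[leRHS]mul1r ler_wpM2r ?ler0n ?we.
have := ler_wpM2l (ltW neT0) le1; apply: le_trans.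
rewrite mulr_suml mulr_sumr; apply: ler_sum => phi hphi.
rewrite mulrCA ler_wpM2l ?w0 //.
by have := dual phi hphi; rewrite -(ler_nat R) -addn1 natrD !natrM.
Qed.

End Tight.

(** With weights scaled by [K], the density of [H] in the blow-up is at most a constant times
    [2 ^ - (K * c0)] and that of [T] at least a constant times [2 ^ - (K * c)]. *)
Lemma dual_not_dominates (H T : sgraph) (m : {set T} + T -> nat) :
    nonempty_graph T -> is_forest H -> is_forest T -> no_isolated H ->
  dual_weights H m -> ~ @dominates H T.
Proof.
move=> T_nonempty forH forT isoH dual dom.
set c := cost m [ffun v : T => v].
(* The least integer above [ne H * c / ne T], hence a lower bound for every cost. *)
pose c0 := (ne H * c %/ ne T).+1.
have c0_gt : (ne H * c < c0 * ne T)%N by apply: ltn_ceil.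
have c0_le phi : phi \in homs H T -> (c0 <= cost m phi)%N.
  by move=> hphi; rewrite ltn_divLR // [ltnRHS]mulnC; exact: dual.
(* Exactly the constant lost in the two density bounds after raising them to the powers [ne T] and
   [ne H]; it is also the scale of the weights. *)
pose K := (#|homs H T| ^ ne T * #|T| ^ (nv T * ne H))%N.
pose mK i := (K * m i)%N.
have costK (F : sgraph) (phi : {ffun F -> T}) : cost mK phi = (K * cost m phi)%N.
  by rewrite /cost mulnDr !big_distrr.
pose b := #|bit mK|.
have T0 : (0 < #|T|)%N.
  by have [e /edgesP[v _]] := card_gt0P T_nonempty; apply/card_gt0P; exists v.
have nvB : nv (blowup mK) = (#|T| * 2 ^ b)%N.
  by rewrite /nv card_prod -[#|{set _}|]cardsT -powersetT card_powerset cardsT.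
have leH : (#|homs H (blowup mK)| * 2 ^ (K * c0) <= #|homs H T| * 2 ^ (b * nv H))%N.
  apply: leq_trans (leq_mul (card_homs_blowup mK isoH) (leqnn _)) _.
  rewrite big_distrl /= -sum_nat_const; apply: leq_sum => phi hphi.
  rewrite -(card_lifts mK forH hphi) leq_mul2l leq_exp2l // costK leq_mul2l.
  by rewrite c0_le // !orbT.
have leT : (2 ^ (b * nv T) <= #|homs T (blowup mK)| * 2 ^ (K * c))%N.
  by rewrite -(card_lifts mK forT (id_homs T)) costK leq_mul2r leq_lifts_homs_blowup orbT.
have pow_gt0 j : 0 < (2 ^ j)%:R :> rat by rewrite ltr0n expn_gt0.
have T0r : 0 < #|T|%:R :> rat by rewrite ltr0n.
have densH : homdens H (blowup mK) <= #|homs H T|%:R / (2 ^ (K * c0))%:R.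
  rewrite /homdens nvB -natrX ler_pdivlMr ?pow_gt0 // mulrAC ler_pdivrMr; last first.
    by rewrite ltr0n expn_gt0 muln_gt0 T0 expn_gt0.
  rewrite -!natrM ler_nat; apply: leq_trans leH _.
  by rewrite leq_mul2l expnMn -expnM leq_pmull ?orbT // expn_gt0 T0.
have densT : (#|T| ^ nv T * 2 ^ (K * c))%:R^-1 <= homdens T (blowup mK).
  have den0 : (0 < #|T| ^ nv T * 2 ^ (K * c))%N by rewrite muln_gt0 !expn_gt0 T0.
  rewrite /homdens nvB -natrX -[leLHS]mul1r ler_pdivrMr ?ltr0n // mulrAC ler_pdivlMr; last first.
    by rewrite ltr0n expn_gt0 muln_gt0 T0 expn_gt0.
  by rewrite mul1r -natrM ler_nat expnMn -expnM mulnCA leq_mul2l leT orbT.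
have homdens_ge0 : 0 <= homdens H (blowup mK) by rewrite divr_ge0 ?exprn_ge0 ?ler0n.
have : (#|T| ^ nv T * 2 ^ (K * c))%:R^-1 ^+ ne H <=
       (#|homs H T|%:R / (2 ^ (K * c0))%:R) ^+ ne T :> rat.
  apply: le_trans (le_trans (dom (blowup mK)) _).
    by rewrite lerXn2r ?nnegrE ?invr_ge0 ?ler0n // (le_trans _ densT) ?invr_ge0 ?ler0n.
  by rewrite lerXn2r ?nnegrE // divr_ge0 ?ler0n.
rewrite exprVn expr_div_n -!natrX -[leLHS]mul1r ler_pdivrMr; last first.
  by rewrite ltr0n expn_gt0 muln_gt0 !expn_gt0 T0.
rewrite mulrAC ler_pdivlMr; last by rewrite ltr0n !expn_gt0.
rewrite mul1r -natrM ler_nat expnMn -!expnM mulnA -/K.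
move: K {mK costK b nvB leH leT densH densT homdens_ge0} => K.
(* The exponents differ by at least [K], so domination would give [2 ^ K <= K]. *)
have : (2 ^ (K * c * ne H + K) <= 2 ^ (K * c0 * ne T))%N.
  by rewrite leq_exp2l // -!mulnA -mulnSr leq_mul2l [(c * _)%N]mulnC c0_gt orbT.
move=> /leq_trans le1 /le1; rewrite expnD mulnC leq_pmul2r ?expn_gt0 //.
by rewrite leqNgt ltn_expl.
Qed.

Theorem theorem2p5 (R : realType) (H T : sgraph)
    (H_nonempty : nonempty_graph H) (T_nonempty : nonempty_graph T)
    (H_forest : is_forest H) (T_forest : is_forest T)
    (H_no_isolated : no_isolated H) :
  dominates H T <-> lp_value R H T = (ne T)%:R.
Proof.
have [[la [la0 lap] [lae lav]]|[m dual]] := tight_or_dual H T.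
  have [w wf wT] := tight_solution R H_nonempty T_nonempty la0 lap lae lav.
  by split=> _; [apply: lp_value_tight wf wT | apply: dominates_tight wf wT].
split=> [/(dual_not_dominates T_nonempty H_forest T_forest H_no_isolated dual)//|lpT].
have := lp_value_lt_dual R H_nonempty T_nonempty dual.
by rewrite lpT ltxx.
Qed.
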